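(* Let $\mathcal{S}$ be a recognizable substitution on a finite alphabet $\mathcal{A}$ with minimal subshift, let $\mathsf{A}$ be its set of address labels, let $\lambda$ be the Perron–Frobenius eigenvalue of its substitution matrix, and let $\mathfrak{F}$ be the infinite interval exchange transformation given by a dual substitution $\mathcal{S}_*$. For any $n\in\mathbb{N}$ there is an exchange of $n(|\mathsf{A}|-|\mathcal{A}|)+|\mathcal{A}|$ intervals that is equal to $\mathfrak{F}$ on all but $|\mathcal{A}|$ intervals of total Lebesgue measure $\le\lambda^{-n}$.
   Context: An exchange of $r$ intervals is a bijection of $[0,1)$ for which $[0,1)$ is partitioned into $r$ half-open intervals $[a,b)$ on each of which the map is a translation; ''all but $|\mathcal{A}|$ intervals'' refers to these $r$ intervals. **Substitutions.** A substitution $\mathcal{S}$ on a finite alphabet $\mathcal{A}$ assigns to each $\alpha\in\mathcal{A}$ a nonempty finite word $\mathcal{S}(\alpha)=\mathcal{S}(\alpha)(0)\,\mathcal{S}(\alpha)(1)\cdots\mathcal{S}(\alpha)(|\mathcal{S}(\alpha)|-1)$ over $\mathcal{A}$; it extends to words by concatenation, which defines $\mathcal{S}^n(\alpha)$. Let $\mathcal{L}$ be the set of all subwords of all words $\mathcal{S}^n(\alpha)$, and let $\Sigma\subset\mathcal{A}^{\mathbb{Z}}$ (product topology) be the set of bi-infinite sequences all of whose finite subwords lie in $\mathcal{L}$. The shift is $(\sigma(\tau))(k)=\tau(k+1)$. The subshift is minimal if every $\sigma$-orbit is dense in $\Sigma$. For $\tau\in\Sigma$, $\mathcal{S}(\tau)=\cdots\mathcal{S}(\tau(-1))\mathcal{S}(\tau(0))\mathcal{S}(\tau(1))\cdots$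 with $\mathcal{S}(\tau(0))$ starting at coordinate $0$. $\mathcal{S}$ is recognizable if for every $\tau\in\Sigma$ there are a unique $\tau'\in\Sigma$ and $0\le k\le|\mathcal{S}(\tau'(0))|-1$ with $\tau=\sigma^k(\mathcal{S}(\tau'))$. Write $[\alpha]=\{\tau\in\Sigma:\tau(0)=\alpha\}$. The substitution matrix $M$ has entry $M_{\alpha\beta}$ equal to the number of occurrences of $\alpha$ in $\mathcal{S}(\beta)$; $\lambda$ is its Perron–Frobenius eigenvalue. **Measure.** $\mu$ is a $\sigma$-invariant Borel probability measure on $\Sigma$. Standing conventions: $\lambda>1$, $\mu([\alpha])>0$ for each $\alpha\in\mathcal{A}$, and $\mu(\mathcal{S}^n([\alpha]))=\mu([\alpha])/\lambda^n$ for all $\alpha\in\mathcal{A}$, $n\ge0$. **Addresses.** Let $\mathsf{A}=\{(\alpha,j):\alpha\in\mathcal{A},\ 0\le j\le|\mathcal{S}(\alpha)|-1\}$ (the address labels) and, for $\alpha\in\mathcal{A}$, $\mathsf{T}(\alpha)=\{(\beta,j)\in\mathsf{A}:\mathcal{S}(\beta)(j)=\alpha\}$. An address is a finite or infinite sequence $((\alpha_1,j_1),(\alpha_2,j_2),\dots)$ in $\mathsf{A}$ with $(\alpha_k,j_k)\in\mathsf{T}(\alpha_{k-1})$ for all $k>1$; $\mathbf{A}_n$ is the set of addresses of length $n$. **Partitions of $[0,1)$.** Choose $\Phi_0:\mathcal{A}\to[0,1)$ so that the intervals $[\Phi_0(\alpha),\Phi_0(\alpha)+\mu([\alpha]))$,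 $\alpha\in\mathcal{A}$, partition $[0,1)$. For each $\alpha\in\mathcal{A}$ choose an ordering of $\mathsf{T}(\alpha)$ and let $\phi:\mathsf{T}(\alpha)\to[0,\mu([\alpha]))$ give the left endpoints of the partition, in that order, of $[0,\mu([\alpha]))$ into intervals $[\phi(\beta,j),\phi(\beta,j)+\mu([\beta])/\lambda)$, $(\beta,j)\in\mathsf{T}(\alpha)$. (Since the sets $\mathsf{T}(\alpha)$ partition $\mathsf{A}$, this defines $\phi$ on $\mathsf{A}$. The orderings are recorded by a dual substitution $\mathcal{S}_*$, where $\mathcal{S}_*(\alpha)$ lists the letters $\beta$ of the elements $(\beta,j)\in\mathsf{T}(\alpha)$ in order; ''given by $\mathcal{S}_*$'' means given by these choices.) For $\mathbf{a}=((\alpha_1,j_1),\dots,(\alpha_n,j_n))\in\mathbf{A}_n$ put $$\Phi_n(\mathbf{a})=\Phi_0(\mathcal{S}(\alpha_1)(j_1))+\sum_{k=1}^n\frac{\phi(\alpha_k,j_k)}{\lambda^{k-1}},\qquad \mathbf{I}(\mathbf{a})=\Big[\Phi_n(\mathbf{a}),\Phi_n(\mathbf{a})+\frac{\mu([\alpha_n])}{\lambda^n}\Big).$$ For each $n$ the intervals $\mathbf{I}(\mathbf{a})$, $\mathbf{a}\in\mathbf{A}_n$, partition $[0,1)$, and these partitions are successively refining. **The map $\mathfrak{F}$.** For an address $\mathbf{a}=((\alpha_k,j_k))_k$ let $\mathbf{n}(\mathbf{a})$ be the smallest $k$ with $j_k<|\mathcal{S}(\alpha_k)|-1$ ($\infty$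 if there is none). If $\mathbf{n}(\mathbf{a})=N<\infty$, define $\mathcal{V}(\mathbf{a})$ by replacing $(\alpha_N,j_N)$ with $(\alpha_N,j_N+1)$, replacing the first $N-1$ entries by the unique address $((\beta_1,0),\dots,(\beta_{N-1},0))$ with $\beta_{N-1}=\mathcal{S}(\alpha_N)(j_N+1)$ and $\beta_{k-1}=\mathcal{S}(\beta_k)(0)$, and leaving all entries of index $>N$ unchanged. For $x\in[0,1)$ let $\mathbf{a}(x)$ be the infinite address whose length-$n$ prefix $\mathbf{a}_n(x)$ is, for each $n$, the unique element of $\mathbf{A}_n$ with $x\in\mathbf{I}(\mathbf{a}_n(x))$, and let $\mathbf{n}(x)=\mathbf{n}(\mathbf{a}(x))$. For $x$ with $\mathbf{n}(x)=N<\infty$ the infinite interval exchange transformation is $$\mathfrak{F}(x)=x-\Phi_N(\mathbf{a}_N(x))+\Phi_N(\mathcal{V}(\mathbf{a}_N(x))).$$ *)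

(* Defs.v *)
From HB Require Import structures.
From mathcomp Require Import all_boot all_order all_algebra.
From mathcomp Require Import all_classical all_reals all_analysis.
From mathcomp Require Import complex.

Set Implicit Arguments.
Unset Strict Implicit.
Unset Printing Implicit Defensive.

Import Order.TTheory GRing.Theory Num.Theory.
Import numFieldNormedType.Exports.

Local Open Scope classical_set_scope.
Local Open Scope ring_scope.

(* Measurable types in the library carry a distinguished point, hence so does
   the alphabet; its value plays no role in any definition below. *)
#[short(type="alphabetType")]
HB.structure Definition Alphabet := {T of Finite T & isPointed T}.

(** * Substitutions and their subshifts *)

Record substitution (A : Type) := Substitution {
  subst_letter :> A -> seq A;
  subst_letter_gt0 : forall a, (0 < size (subst_letter a))%N
}.

Definition subst_word (A : Type) (S : substitution A) (w : seq A) : seq A :=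
  flatten (map S w).

Definition language (A : eqType) (S : substitution A) (w : seq A) : Prop :=
  exists (n : nat) (a : A), infix w (iter n (subst_word S) [:: a]).

Definition subshift (A : eqType) (S : substitution A) : set (int -> A) :=
  [set tau | forall (k : int) (m : nat),
     language S [seq tau (k + i%:Z) | i <- iota 0 m]].

(* [shift k] is the k-th power of the shift [shift 1], for k in Z. *)
Definition shift (A : Type) (k : int) (tau : int -> A) : int -> A :=
  fun i => tau (i + k).

(* ... S(tau(-1)) . S(tau(0)) S(tau(1)) ..., with S(tau(0)) starting at 0.
   Since images of letters are nonempty, the coordinate n >= 0 is found in
   S(tau(0)) ... S(tau(n)), and the coordinate Negz n = -(n+1) is the letter of
   index n, counted from the right, of S(tau(-(n+1))) ... S(tau(-1)).  The
   default value of [nth] is thus never used. *)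
Definition subst_bi (A : Type) (S : substitution A) (tau : int -> A)
    : int -> A := fun k =>
  match k with
  | Posz n =>
      nth (tau 0) (subst_word S [seq tau (Posz i) | i <- iota 0 n.+1]) n
  | Negz n =>
      nth (tau 0)
        (rev (subst_word S [seq tau (Negz i) | i <- rev (iota 0 n.+1)])) n
  end.

Definition recognizable (A : eqType) (S : substitution A) : Prop :=
  forall tau, subshift S tau ->
    exists! p : (int -> A) * nat,
      [/\ subshift S p.1, (p.2 < size (S (p.1 0%R)))%N
        & tau = shift p.2%:Z (subst_bi S p.1)].

Definition cylinder (A : eqType) (S : substitution A) (a : A)
    : set (int -> A) :=
  [set tau | subshift S tau /\ tau 0 = a].

Notation full_shift A := {ptws int -> discrete_topology A}.

Definition borel_full_shift (A : alphabetType) :=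
  g_sigma_algebraType (@open (full_shift A)).

Definition minimal_subshift (A : alphabetType) (S : substitution A) : Prop :=
  forall tau, subshift S tau ->
    subshift S
    `<=` @closure (full_shift A) [set shift k tau | k in [set: int]].

(* A Borel probability measure on the closed set [subshift S] is a Borel
   probability measure on the full shift that gives it full mass. *)
Definition invariant_on_subshift (R : realType) (A : alphabetType)
    (S : substitution A) (mu : probability (borel_full_shift A) R) : Prop :=
  mu (subshift S) = 1%E /\
  forall E : set (borel_full_shift A), measurable E ->
    mu (shift 1 @^-1` E) = mu E.

Definition letter_mass (R : realType) (A : alphabetType) (S : substitution A)
    (mu : probability (borel_full_shift A) R) (a : A) : R :=
  fine (mu (cylinder S a)).

(** * Perron-Frobenius eigenvalue *)

Definition subst_mx (R : realType) (A : finType) (S : substitution A)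
    : 'M[R]_#|A| :=
  \matrix_(i, j) (count_mem (enum_val i) (S (enum_val j)))%:R.

Definition perron_frobenius (R : realType) n (M : 'M[R]_n) (lambda : R) : Prop :=
  [/\ 0 <= lambda, eigenvalue M lambda
    & forall z : R[i], eigenvalue (map_mx (real_complex R) M) z ->
        `|z| <= (lambda%:C)%C].

(** * Addresses *)

Section Addresses.
Context (A : finType) (S : substitution A).

(* The address label (alpha, j), 0 <= j < |S(alpha)|. *)
Definition label := {a : A & 'I_(size (S a))}.

(* S(alpha)(j) *)
Definition letter (b : label) : A := tnth (in_tuple (S (tag b))) (tagged b).

Definition labels_over (a : A) : {set label} := [set b | letter b == a].

Definition is_address (s : seq label) : bool :=
  sorted (fun b c => c \in labels_over (tag b)) s.

Definition is_last (b : label) : bool :=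
  (tagged b).+1 == size (S (tag b)).

Definition label0 (a : A) : label :=
  Tagged (fun a => 'I_(size (S a))) (Ordinal (subst_letter_gt0 S a)).

(* (alpha, j + 1), for a label (alpha, j) that is not last. *)
Definition label_succ (b : label) : label :=
  Tagged (fun a => 'I_(size (S a))) (insubd (tagged b) (tagged b).+1).

(* ((beta_1, 0), ..., (beta_m, 0)) with beta_m = a and
   beta_(k-1) = S(beta_k)(0). *)
Fixpoint zero_address (m : nat) (a : A) : seq label :=
  if m is m'.+1 then rcons (zero_address m' (letter (label0 a))) (label0 a)
  else [::].

(* The map V on finite addresses; an address whose labels are all last, where
   V is undefined, is left unchanged. *)
Definition vershik (s : seq label) : seq label :=
  let i := find (predC is_last) s in
  if drop i s is b :: s' then
    zero_address i (letter (label_succ b)) ++ label_succ b :: s'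
  else s.

(* n(a) = N, for the infinite address whose k-th entry (k >= 1) is a (k - 1). *)
Definition carry_time (a : nat -> label) (N : nat) : Prop :=
  [/\ (0 < N)%N, ~~ is_last (a N.-1)
    & forall i, (i < N.-1)%N -> is_last (a i)].

(* The choice of an ordering of each T(alpha); the dual substitution S_* maps
   alpha to [map tag (dual alpha)]. *)
Definition is_dual_order (dual : A -> seq label) : Prop :=
  forall a, uniq (dual a) /\ dual a =i labels_over a.

(** * The infinite interval exchange transformation *)

Context (R : realType) (m : A -> R) (lambda : R).
Context (Phi0 : A -> R) (dual : A -> seq label).

(* Left endpoint of the interval of b when intervals of lengths
   m(beta)/lambda, for (beta, j) in T(letter b), are laid out from 0 in the
   chosen order. *)
Definition phi (b : label) : R :=
  let s := dual (letter b) in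
  \sum_(c <- take (index b s) s) m (tag c) / lambda.

(* Only meaningful for nonempty addresses. *)
Definition Phi (s : seq label) : R :=
  if s is b :: _ then
    Phi0 (letter b) + \sum_(k < size s) phi (nth b s k) / lambda ^+ k
  else 0.

Definition address_itv (s : seq label) : set R :=
  if s is b :: s' then
    `[Phi s, Phi s + m (tag (last b s')) / lambda ^+ size s[
  else set0.

(* a = a(x): each nonempty prefix of a is the unique address of its length
   whose interval contains x. *)
Definition coding (x : R) (a : nat -> label) : Prop :=
  forall s : seq label, (0 < size s)%N ->
    (is_address s /\ address_itv s x) <-> s = mkseq a (size s).

(* The graph of F, which is defined only at the x with n(x) finite. *)
Definition frakF_graph (x y : R) : Prop :=
  exists (a : nat -> label) (N : nat),
    [/\ coding x a, carry_time a N
      & y = x - Phi (mkseq a N) + Phi (vershik (mkseq a N))].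

Lemma coding_inj x a a' : coding x a -> coding x a' -> a = a'.
Proof.
move=> ca ca'; apply/funext => n.
have sz : size (mkseq a n.+1) = n.+1 by rewrite size_mkseq.
have /ca' [] : (0 < size (mkseq a n.+1))%N by rewrite sz.
have /ca [_] : (0 < size (mkseq a n.+1))%N by rewrite sz.
rewrite sz => /(_ erefl) H /(_ H) E _.
have := congr1 (fun s => nth (a n) s n) E.
by rewrite !nth_mkseq.
Qed.

Lemma carry_time_inj a N N' : carry_time a N -> carry_time a N' -> N = N'.
Proof.
case: N => [|N] []// _ /= nl l; case: N' => [|N'] []// _ /= nl' l'.
congr _.+1; case: (ltngtP N N') => // lt.
- by rewrite l' in nl.
- by rewrite l in nl'.
Qed.

Lemma frakF_graph_functional x y y' :
  frakF_graph x y -> frakF_graph x y' -> y = y'.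
Proof.
move=> [a [N [ca tN ->]]] [a' [N' [ca' tN' ->]]].
by rewrite -(coding_inj ca ca') in tN' *; rewrite (carry_time_inj tN tN').
Qed.

End Addresses.

(** * Interval exchanges *)

(* f is an exchange of the r intervals [l i, u i); [partition] requires them
   to be nonempty. *)
Definition interval_exchange (R : realType) (r : nat) (l u : 'I_r -> R)
    (f : R -> R) : Prop :=
  [/\ set_bij `[0, 1[%classic `[0, 1[%classic f,
      partition [set: 'I_r] (fun i => `[l i, u i[%classic) `[0, 1[%classic
    & forall i, exists t : R, forall x, x \in `[l i, u i[ -> f x = x + t].

(* Main.v *)
Require Import Defs.
From HB Require Import structures.
From mathcomp Require Import all_boot all_order all_algebra.
From mathcomp Require Import all_classical all_reals all_analysis.
From mathcomp Require Import zify ring.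

Set Implicit Arguments.
Unset Strict Implicit.
Unset Printing Implicit Defensive.

Import Order.TTheory GRing.Theory Num.Theory.
Import numFieldNormedType.Exports.

Local Open Scope classical_set_scope.
Local Open Scope ring_scope.

(** The map F acts on an address as an odometer: it carries through the leading
    last labels, increments the first label that is not last, and resets the
    labels before it to zero.  At each position k an address whose labels before
    k are all last is determined by its label b at k, and F translates its
    interval onto the interval of the incremented address, in which all labels
    before k are zero.  Cut the process at length n.  The non-last labels b at
    the first n positions give n (|label| - |A|) intervals on which F is known;
    what is left consists of the addresses of length n all of whose labels are
    last, one for each letter alpha, with intervals of length m(alpha) / lambda^n
    and total length lambda^-n.  The images of the known intervals leave out the
    addresses of length n all of whose labels are zero, again one for each letter
    alpha and with the same lengths.  Translating the all-last interval of alpha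
    onto the all-zero interval of alpha completes F to an exchange of intervals.

    The source intervals tile [0, 1) for the same reason as the target intervals:
    if d chooses one label d(alpha) over each letter alpha as its tag, and if the
    interval of an address whose labels are all of the form d(alpha) is split
    into the intervals of its one-label extensions, the extensions by labels of
    the form d(alpha) form the next level, while the others are never split again
    ([sum_levels]).  The sources are the case of the last labels and the targets
    the case of the first ones.  Tilings are handled as identities between sums
    of indicator functions, so that regrouping pieces is regrouping a sum.

    The splitting step rests on one identity for the masses m of the letters,
    m(alpha) = sum of m(beta) / lambda over the labels (beta, j) with
    S(beta)(j) = alpha ([letter_mass_split]).  Recognizability says that the
    cylinder of alpha is the disjoint union of the sets sigma^j(S([beta])), which
    have mass m(beta) / lambda by invariance and scaling; these sets are closed,
    hence Borel, because the full shift is compact and S is continuous. *)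

(** * Topology of the full shift *)

Section Topology.
Variable A : alphabetType.
Implicit Types (t tau : full_shift A) (s : seq int).

(** The discrete form of continuity: on a product of discrete spaces it yields
    clopen sets and continuous maps. *)
Definition window_determined (T : Type) (F : (int -> A) -> T) : Prop :=
  exists s : seq int, forall t tau : int -> A,
    map t s = map tau s -> F t = F tau.

Lemma near_window tau s : \forall t \near tau, map t s = map tau s.
Proof.
have F := @nbhs_pfilter (full_shift A) tau.
elim: s => [|k s IH]; first by apply: filterE.
have Hk : \forall t \near tau, t k = tau k.
  exact: (@proj_continuous int (fun=> discrete_topology A) k tau
            _ (discrete_set1 (tau k))).
apply: filterS2 _ Hk IH => t /= tk ts.
by rewrite ts; congr (_ :: _).
Qed.

Lemma window_determined_open (P : (int -> A) -> Prop) :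
  window_determined P -> @open (full_shift A) [set t | P t].
Proof.
move=> [s Ps]; rewrite openE => tau /= Ptau.
have F := @nbhs_pfilter (full_shift A) tau.
by apply: filterS _ (near_window tau s) => t /= /Ps ->.
Qed.

Lemma window_determined_closed (P : (int -> A) -> Prop) :
  window_determined P -> @closed (full_shift A) [set t | P t].
Proof.
move=> [s Ps]; rewrite -openC.
apply: (@window_determined_open (fun t => ~ P t)).
by exists s => t tau /Ps ->.
Qed.

Lemma window_determined_continuous (F : (int -> A) -> (int -> A)) :
  (forall k, window_determined (fun t => F t k)) ->
  continuous (F : full_shift A -> full_shift A).
Proof.
move=> wF tau.
have FF := @nbhs_pfilter (full_shift A) tau.
apply/cvg_sup => k U /= [_ [[B oB <-] /= BF sBU]].
have [s Fs] := wF k.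
apply: filterS _ (near_window tau s) => t /= /Fs E.
by apply: sBU; rewrite /= E.
Qed.

Lemma full_shift_hausdorff : hausdorff_space (full_shift A).
Proof.
apply: (@hausdorff_product int (fun=> discrete_topology A)) => _.
exact: discrete_hausdorff.
Qed.

Lemma full_shift_compact : compact [set: full_shift A].
Proof.
have := @tychonoff int (fun=> discrete_topology A) (fun=> setT) _.
set X := [set _ | _]; have -> : X = setT by apply/seteqP; split.
apply=> _; apply: finite_compact; exact: (@finite_finset A).
Qed.

(** Closed sets have closed images because the full shift is compact and
    Hausdorff; it is what makes the images of cylinders under the substitution
    measurable. *)
Lemma closed_continuous_image (F : full_shift A -> full_shift A)
    (C : set (full_shift A)) :
  continuous F -> closed C -> closed (F @` C).
Proof.
move=> cF cC; apply: compact_closed; first exact: full_shift_hausdorff.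
apply: continuous_compact; first exact: continuous_subspaceT.
exact: subclosed_compact cC full_shift_compact _.
Qed.

Lemma closed_measurable_full_shift (C : set (full_shift A)) :
  closed C -> @measurable _ (borel_full_shift A) C.
Proof.
move=> cC; rewrite -[C]setCK; apply: measurableC.
by apply: sub_sigma_algebra; exact: closed_openC.
Qed.

Variable S : substitution A.

Lemma subshift_closed : @closed (full_shift A) (subshift S).
Proof.
have -> : subshift S = \bigcap_(km in [set: int * nat])
   [set tau | language S [seq tau (km.1 + i%:Z) | i <- iota 0 km.2]].
  apply/seteqP; split=> [tau st [k m] _|tau st k m]; first exact: st.
  exact: (st (k, m)).
apply: closed_bigI => -[k m] _; apply: window_determined_closed.
exists [seq k + i%:Z | i <- iota 0 m] => t tau E /=.
move: E; rewrite -!map_comp => E.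
have E' : [seq t (k + i%:Z) | i <- iota 0 m]
        = [seq tau (k + i%:Z) | i <- iota 0 m] := E.
by rewrite E'.
Qed.

Lemma cylinder_closed a : @closed (full_shift A) (cylinder S a).
Proof.
apply: closedI; first exact: subshift_closed.
apply: (@window_determined_closed (fun t => t 0 = a)).
by exists [:: 0] => t tau [E]; rewrite E.
Qed.

Lemma shift_continuous (k : int) :
  continuous (Defs.shift k : full_shift A -> full_shift A).
Proof.
by apply: window_determined_continuous => i; exists [:: i + k] => t tau [].
Qed.

Lemma subst_bi_continuous :
  continuous (subst_bi S : full_shift A -> full_shift A).
Proof.
apply: window_determined_continuous => -[n|n]; rewrite /subst_bi.
  exists (0 :: map Posz (iota 0 n.+1)); move: (iota 0 n.+1) => w t tau.
  move=> /= [-> E]; congr (nth _ (subst_word _ _) _).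
  by move: E; rewrite -!map_comp.
exists (0 :: map Negz (rev (iota 0 n.+1))); move: (rev _) => w t tau.
move=> /= [-> E]; congr (nth _ (rev (subst_word _ _)) _).
by move: E; rewrite -!map_comp.
Qed.

Lemma label_cell_closed (a : A) (j : int) :
  @closed (full_shift A) (Defs.shift j @` (subst_bi S @` cylinder S a)).
Proof.
apply: closed_continuous_image; first exact: shift_continuous.
apply: closed_continuous_image; first exact: subst_bi_continuous.
exact: cylinder_closed.
Qed.

End Topology.

(** * The substitution preserves its subshift *)

Section Words.
Variables (A : eqType) (S : substitution A).
Implicit Types (w v : seq A) (tau : int -> A).

Lemma subst_word_cat w v :
  subst_word S (w ++ v) = subst_word S w ++ subst_word S v.
Proof. by rewrite /subst_word map_cat flatten_cat. Qed.

Lemma leq_size_subst_word w : (size w <= size (subst_word S w))%N.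
Proof.
elim: w => //= a w IH; rewrite /subst_word /= size_cat -add1n.
by apply: leq_add => //; exact: subst_letter_gt0.
Qed.

Lemma language_infix w v : infix w v -> language S v -> language S w.
Proof. by move=> wv [n [a va]]; exists n, a; exact: infix_trans wv va. Qed.

Lemma language_subst_word w : language S w -> language S (subst_word S w).
Proof.
move=> [n [a /infixP[p [s E]]]]; exists n.+1, a; apply/infixP.
exists (subst_word S p), (subst_word S s).
by rewrite iterS E !subst_word_cat.
Qed.

(** The window S(tau(0)) ... S(tau(n)) used for coordinate n is a prefix of every
    longer one, so that one window serves all coordinates below N; likewise on
    the left with suffixes. *)
Lemma subst_bi_pos tau n N : (n < N)%N ->
  subst_bi S tau (Posz n) =
  nth (tau 0) (subst_word S [seq tau (Posz i) | i <- iota 0 N]) n.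
Proof.
move=> nN; rewrite -(subnKC nN) iotaD map_cat subst_word_cat nth_cat.
by rewrite (leq_trans _ (leq_size_subst_word _)) // size_map size_iota.
Qed.

Lemma subst_bi_neg tau n N : (n < N)%N ->
  subst_bi S tau (Negz n) =
  nth (tau 0) (rev (subst_word S [seq tau (Negz i) | i <- rev (iota 0 N)])) n.
Proof.
move=> nN; rewrite -(subnKC nN) iotaD rev_cat map_cat subst_word_cat rev_cat.
rewrite nth_cat size_rev (leq_trans _ (leq_size_subst_word _)) //.
by rewrite size_map size_rev size_iota.
Qed.

Lemma central_windowE tau N :
  [seq tau (Negz i) | i <- rev (iota 0 N)]
    ++ [seq tau (Posz i) | i <- iota 0 N]
  = [seq tau (- N%:Z + i%:Z) | i <- iota 0 (N + N)].
Proof.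
rewrite iotaD map_cat add0n; congr (_ ++ _).
  apply: (@eq_from_nth _ (tau 0)); rewrite !size_map size_rev size_iota //.
  move=> i iN; rewrite !(nth_map 0%N) ?size_rev ?size_iota //.
  rewrite nth_rev ?size_iota // !nth_iota //; last lia.
  by congr tau; lia.
have -> : iota N N = map (addn N) (iota 0 N) by rewrite -iotaDl addn0.
rewrite -map_comp; apply: eq_map => i /=.
by congr tau; lia.
Qed.

(** Every window of S(tau) lies in the image of a central window of tau, of
    radius N large enough since images of letters are nonempty. *)
Lemma subst_bi_subshift tau : subshift S tau -> subshift S (subst_bi S tau).
Proof.
move=> tauS k m.
pose N := (`|k| + m)%N.
pose L := subst_word S [seq tau (Negz i) | i <- rev (iota 0 N)].
pose P := subst_word S [seq tau (Posz i) | i <- iota 0 N].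
have LN : (N <= size L)%N.
  apply: leq_trans (leq_size_subst_word _).
  by rewrite size_map size_rev size_iota.
have PN : (N <= size P)%N.
  by apply: leq_trans (leq_size_subst_word _); rewrite size_map size_iota.
have nthE (l : int) : - N%:Z <= l < N%:Z ->
    subst_bi S tau l = nth (tau 0) (L ++ P) (absz ((size L)%:Z + l)).
  case: l => n lN; rewrite nth_cat.
    rewrite (@subst_bi_pos _ _ N) //; last lia.
    by case: ifP => ?; [lia|congr nth; lia].
  rewrite (@subst_bi_neg _ _ N); last lia.
  rewrite nth_rev -/L; last lia.
  by case: ifP => ?; [congr nth; lia|lia].
have -> : [seq subst_bi S tau (k + i%:Z) | i <- iota 0 m]
    = take m (drop (absz ((size L)%:Z + k)) (L ++ P)).
  have sz : size (take m (drop (absz ((size L)%:Z + k)) (L ++ P))) = m.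
    by rewrite size_takel // size_drop size_cat; lia.
  apply: (@eq_from_nth _ (tau 0)); rewrite size_map size_iota ?sz // => i im.
  rewrite (nth_map 0%N) ?size_iota // nth_iota // nth_take // nth_drop.
  rewrite add0n.
  by rewrite nthE; [congr nth; lia|lia].
apply: (@language_infix _ (L ++ P)).
  exact: (infix_trans (infix_take _ _) (infix_drop _ _)).
rewrite /L /P -subst_word_cat central_windowE.
by apply: language_subst_word; exact: tauS.
Qed.

Lemma shift_subshift (k : int) tau :
  subshift S tau -> subshift S (Defs.shift k tau).
Proof.
move=> tauS l m.
have -> : [seq Defs.shift k tau (l + i%:Z) | i <- iota 0 m]
        = [seq tau ((k + l) + i%:Z) | i <- iota 0 m].
  by apply: eq_map => i; rewrite /Defs.shift; congr tau; lia.
exact: tauS.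
Qed.

Lemma subst_bi_first tau j : (j < size (S (tau 0)))%N ->
  subst_bi S tau (Posz j) = nth (tau 0) (S (tau 0)) j.
Proof. by move=> jS; rewrite /= /subst_word /= nth_cat jS. Qed.

End Words.

(** * Masses of letters *)

Section Measure.
Variables (R : realType) (A : alphabetType) (S : substitution A) (lambda : R).
Variable mu : probability (borel_full_shift A) R.
Hypothesis S_recognizable : recognizable S.
Hypothesis mu_invariant : invariant_on_subshift S mu.
Hypothesis mu_scaling : forall (a : A) (n : nat),
     mu (iter n (subst_bi S) @` cylinder S a)
     = (letter_mass S mu a / lambda ^+ n)%:E.

Lemma letter_massE (a : A) : mu (cylinder S a) = (letter_mass S mu a)%:E.
Proof.
by have := mu_scaling a 0; rewrite /= image_id expr0 divr1.
Qed.

Lemma finite_partition_measure (I : finType) (P : pred I)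
    (F : I -> set (borel_full_shift A)) (E : set (borel_full_shift A)) :
  (forall i, P i -> measurable (F i)) ->
  (forall i j x, P i -> P j -> F i x -> F j x -> i = j) ->
  (forall x, E x <-> exists2 i, P i & F i x) ->
  mu E = (\sum_(i | P i) mu (F i))%E.
Proof.
move=> mF inj cov; rewrite -big_enum fsbig_seq ?enum_uniq //=.
have inE i : [set` enum P] i = P i by rewrite /= mem_enum.
rewrite -measure_fin_bigcup.
- congr (mu _); apply/seteqP; split=> x.
    by move=> /cov[i Pi Fi]; exists i => //; rewrite inE.
  by move=> [i]; rewrite inE => Pi Fi; apply/cov; exists i.
- exact: finite_finset.
- by move=> i j; rewrite !inE => Pi Pj [x [Fi Fj]]; exact: inj Fi Fj.
- by move=> i; rewrite inE; exact: mF.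
Qed.

Lemma sum_letter_mass : \sum_(a : A) letter_mass S mu a = 1.
Proof.
have [mu1 _] := mu_invariant.
apply: EFin_inj; rewrite -mu1 -sumEFin.
rewrite (@finite_partition_measure _ predT (cylinder S)).
- by apply: eq_bigr => a _; rewrite letter_massE.
- by move=> a _; apply: closed_measurable_full_shift; exact: cylinder_closed.
- by move=> a b x _ _ [_ <-] [].
- by move=> x; split=> [Sx|[a _ []]//]; exists (x 0).
Qed.

(** The points of the subshift whose desubstitution places coordinate 0 at the
    letter of index j of S(alpha), for the label b = (alpha, j). *)
Definition label_cell (b : label S) : set (full_shift A) :=
  Defs.shift (Posz (tagged b)) @` (subst_bi S @` cylinder S (tag b)).

(** Invariance is stated for preimages by the shift; the shift is a bijection, so
    it also gives the measure of images. *)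
Lemma shift_image_measure (j : nat) (C : set (full_shift A)) :
  closed C -> mu (Defs.shift (Posz j) @` C) = mu C.
Proof.
move=> cC; elim: j => [|j IH].
  have -> : Defs.shift (Posz 0) = id :> ((int -> A) -> _).
    by apply/funext => t; apply/funext => i; rewrite /Defs.shift addr0.
  by rewrite image_id.
rewrite -IH; have [_ inv] := mu_invariant.
rewrite -(inv (Defs.shift (Posz j.+1) @` C)); last first.
  apply: closed_measurable_full_shift.
  by apply: closed_continuous_image => //; exact: shift_continuous.
have shiftS u : Defs.shift 1 (Defs.shift (Posz j) u) = Defs.shift (Posz j.+1) u.
  by apply/funext => i; rewrite /Defs.shift; congr u; lia.
congr (mu _); apply/seteqP; split=> [t [u Cu E]|_ [u Cu <-]]; exists u => //.
apply/funext => i; have := congr1 (fun v => v (i - 1)) E.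
by rewrite -shiftS /Defs.shift subrK.
Qed.

Lemma label_cell_measure (b : label S) :
  mu (label_cell b) = (letter_mass S mu (tag b) / lambda)%:E.
Proof.
rewrite /label_cell shift_image_measure.
  by have := mu_scaling (tag b) 1; rewrite expr1.
apply: closed_continuous_image; first exact: subst_bi_continuous.
exact: cylinder_closed.
Qed.

Lemma recognizable_inj u v j k :
  subshift S u -> subshift S v ->
  (j < size (S (u 0)))%N -> (k < size (S (v 0)))%N ->
  Defs.shift (Posz k) (subst_bi S v) = Defs.shift (Posz j) (subst_bi S u) ->
  u = v /\ j = k.
Proof.
move=> Su Sv ju kv E.
have [p [_ uniq_p]] :=
  S_recognizable (shift_subshift (Posz j) (subst_bi_subshift Su)).
have pu : p = (u, j) by apply: uniq_p.
have pv : p = (v, k) by apply: uniq_p.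
by move: pv; rewrite pu => -[].
Qed.

Lemma subst_bi_label tau (b : label S) :
  tau 0 = tag b -> subst_bi S tau (Posz (tagged b)) = letter b.
Proof.
by move=> E; rewrite subst_bi_first E // /letter (tnth_nth (tag b)).
Qed.

(** Recognizability makes the label cells over a letter a partition of its
    cylinder: existence of a desubstitution gives the covering, its uniqueness
    the disjointness. *)
Lemma letter_mass_split (a : A) :
  letter_mass S mu a =
  \sum_(b : label S | letter b == a) letter_mass S mu (tag b) / lambda.
Proof.
apply: EFin_inj; rewrite -letter_massE -sumEFin.
rewrite (@finite_partition_measure _ (fun b => letter b == a) label_cell).
- by apply: eq_bigr => b _; rewrite label_cell_measure.
- by move=> b _; apply: closed_measurable_full_shift; exact: label_cell_closed.
- move=> b b' _ _ _ [_ [u [Su u0] <-] <-] [_ [v [Sv v0] <-] E].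
  have [Euv Ej] : u = v /\ tagged b = tagged b' :> nat.
    by apply: recognizable_inj; rewrite ?u0 ?v0.
  case: b b' u0 v0 Ej {E} => [c j] [c' j'] /= u0 v0 Ej.
  have ecc : c = c' by rewrite -u0 -v0 Euv.
  case: c' / ecc j' v0 Ej => j' _ Ej.
  by have -> : j = j' by apply: val_inj.
- move=> tau; split=> [[Stau tau0]|[b /eqP ba [_ [u [Su u0] <-] <-]]].
    have [[u k] [[/= Su ku Etau] _]] := S_recognizable Stau.
    pose b : label S := Tagged (fun a => 'I_(size (S a))) (Ordinal ku).
    have Eb : tau = Defs.shift (Posz (tagged b)) (subst_bi S u) by [].
    exists b; last by exists (subst_bi S u) => //; exists u.
    apply/eqP; rewrite -tau0 Eb /Defs.shift add0r.
    by rewrite subst_bi_label.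
  split; first by apply: shift_subshift; exact: subst_bi_subshift.
  by rewrite /Defs.shift add0r subst_bi_label.
Qed.

End Measure.

(** * Tilings of the unit interval as sums of indicators *)

Section Indicators.
Variable R : realType.
Implicit Types p w x : R.

(** The indicator function of [p, p + w). *)
Definition itv_at p w x : bool := p <= x < p + w.

Lemma itv_at_cat p v w x : 0 <= v -> 0 <= w ->
  (itv_at p (v + w) x = itv_at p v x + itv_at (p + v) w x :> nat)%N.
Proof.
rewrite /itv_at => v0 w0; rewrite addrA.
case: (ltP x (p + v)) => xv.
  rewrite /= addn0 andbT.
  have -> : x < p + v + w by apply: lt_le_trans xv _; rewrite lerDl.
  by rewrite andbT.
have -> : p <= x by apply: le_trans xv; rewrite lerDl.
by rewrite /= ?andbT ?andbF ?add0n.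
Qed.

(** Intervals laid end to end in the order of a sequence, the left endpoint of
    each being the sum of the lengths that precede it: the shape of the map
    [phi]. *)
Lemma itv_at_layout (I : eqType) (s : seq I) (w : I -> R) p x :
  (forall c, 0 <= w c) -> uniq s ->
  (\sum_(c <- s) itv_at (p + \sum_(d <- take (index c s) s) w d) (w c) x
   = itv_at p (\sum_(c <- s) w c) x)%N.
Proof.
move=> w0; elim: s p => [|c s IH] p.
  rewrite !big_nil /itv_at addr0 => _.
  by case: leP => //= px; case: ltP => // /(le_lt_trans px); rewrite ltxx.
move=> /= /andP[cs us]; rewrite !big_cons eqxx take0 big_nil addr0.
rewrite itv_at_cat //; last by apply: sumr_ge0.
congr addn; rewrite -IH // big_seq [RHS]big_seq.
apply: eq_bigr => d ds; case: eqP => [cd|_]; first by rewrite cd ds in cs.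
by rewrite /= big_cons addrA.
Qed.

Lemma sum_bool_gt0 (I : finType) (Q P : pred I) :
  (0 < \sum_(i | Q i) P i)%N -> exists2 i, Q i & P i.
Proof.
move=> h; apply/exists_inP; move: h; apply: contraLR => /exists_inPn P0.
by rewrite big1 // => i Qi; rewrite (negbTE (P0 i Qi)).
Qed.

Lemma sum_bool_le1 (I : finType) (Q P : pred I) i j :
  (\sum_(i | Q i) P i <= 1)%N -> Q i -> Q j -> P i -> P j -> i = j.
Proof.
move=> h Qi Qj Pi Pj; apply/eqP; move: h; apply: contraLR => ij.
rewrite (bigD1 i) //= (bigD1 j) ?Qj 1?eq_sym //= Pi Pj.
by rewrite -ltnNge.
Qed.

End Indicators.

(** * Exchanging the pieces of two tilings *)

Section Gluing.
Variables (R : realType) (r : nat) (l l' w : 'I_r -> R).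
Hypothesis w_gt0 : forall i, 0 < w i.
Hypothesis l_tiling : forall x, (\sum_i itv_at (l i) (w i) x = itv_at 0 1 x)%N.
Hypothesis l'_tiling : forall x, (\sum_i itv_at (l' i) (w i) x = itv_at 0 1 x)%N.

Lemma tiling_exists (k : 'I_r -> R) :
  (forall x, (\sum_i itv_at (k i) (w i) x = itv_at 0 1 x)%N) ->
  forall x, itv_at 0 1 x -> exists i, itv_at (k i) (w i) x.
Proof.
move=> tk x x01.
have [|i _ xi] := @sum_bool_gt0 _ predT (fun i => itv_at (k i) (w i) x).
  by rewrite tk x01.
by exists i.
Qed.

Lemma tiling_uniq (k : 'I_r -> R) :
  (forall x, (\sum_i itv_at (k i) (w i) x = itv_at 0 1 x)%N) ->
  forall x i j, itv_at (k i) (w i) x -> itv_at (k j) (w j) x -> i = j.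
Proof.
move=> tk x i j; apply: (@sum_bool_le1 _ predT (fun i => itv_at _ _ _)) => //.
by rewrite tk; case: itv_at.
Qed.

Lemma tiling_sub (k : 'I_r -> R) :
  (forall x, (\sum_i itv_at (k i) (w i) x = itv_at 0 1 x)%N) ->
  forall x i, itv_at (k i) (w i) x -> itv_at 0 1 x.
Proof.
move=> tk x i xi; have := tk x; rewrite (bigD1 i) //= xi.
by case: itv_at.
Qed.

(** The exchange carrying each piece of the tiling l onto the piece of l' of the
    same index; off [0, 1), where there are no pieces, it is the identity. *)
Definition translate_pieces (x : R) : R :=
  if [pick i | itv_at (l i) (w i) x] is Some i then x + (l' i - l i) else x.

Lemma translateE i x :
  itv_at (l i) (w i) x -> translate_pieces x = x + (l' i - l i).
Proof.
move=> xi; rewrite /translate_pieces.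
case: pickP => [j xj|/(_ i)]; last by rewrite xi.
by rewrite (tiling_uniq l_tiling xi xj).
Qed.

Lemma itv_at_translate p q v (x : R) : itv_at p v x = itv_at q v (x + (q - p)).
Proof.
rewrite /itv_at; congr (_ && _).
  by rewrite addrCA lerDl subr_ge0.
by rewrite -[in RHS](ltrD2r (p - q)) -addrA; congr (_ < _); ring.
Qed.

Lemma translate_exchange :
  interval_exchange l (fun i => l i + w i) translate_pieces.
Proof.
have memE (p v x : R) : `[p, (p + v)[%classic x = itv_at p v x.
  by rewrite /= in_itv.
have mem01 (x : R) : `[0, 1[%classic x = itv_at 0 1 x.
  by rewrite -memE add0r.
split.
- split=> [x|x y|y].
  + rewrite !mem01 => /(tiling_exists l_tiling)[i xi].
    rewrite (translateE xi); apply: (tiling_sub l'_tiling (i := i)).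
    by rewrite -itv_at_translate.
  + rewrite !inE !mem01 => /(tiling_exists l_tiling)[i xi].
    move=> /(tiling_exists l_tiling)[j yj].
    rewrite (translateE xi) (translateE yj) => E.
    have ij : i = j.
      apply: (tiling_uniq l'_tiling (x := x + (l' i - l i))).
        by rewrite -itv_at_translate.
      by rewrite E -itv_at_translate.
    by move: E; rewrite ij => /addIr.
  + rewrite mem01 => /(tiling_exists l'_tiling)[i yi].
    have xi : itv_at (l i) (w i) (y + (l i - l' i)) by rewrite -itv_at_translate.
    exists (y + (l i - l' i)); first by rewrite mem01; exact: tiling_sub xi.
    by rewrite (translateE xi); ring.
- split.
  + apply/seteqP; split=> x.
      by move=> [i _]; rewrite memE mem01; exact: tiling_sub.
    by rewrite mem01 => /(tiling_exists l_tiling)[i xi]; exists i; rewrite ?memE.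
  + move=> i j _ _ [x []]; rewrite !memE; exact: tiling_uniq.
  + by move=> i _; exists (l i); rewrite memE /itv_at lexx ltrDl w_gt0.
- move=> i; exists (l' i - l i) => x; rewrite in_itv; exact: translateE.
Qed.

End Gluing.

(** * Splitting along addresses *)

Section Levels.
Variables (R : realType) (A : finType) (S : substitution A).
Variables (m : A -> R) (lambda : R) (Phi0 : A -> R) (dual : A -> seq (label S)).
Hypothesis m_gt0 : forall a, 0 < m a.
Hypothesis lambda_gt0 : 0 < lambda.
Hypothesis m_split : forall a,
  m a = \sum_(b : label S | letter b == a) m (tag b) / lambda.
Hypothesis dual_order : is_dual_order dual.

Local Notation phi := (phi m lambda dual).
Local Notation Phi := (Phi m lambda Phi0 dual).
Local Notation address_itv := (address_itv m lambda Phi0 dual).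
Local Notation width k a := (m a / lambda ^+ k).

Lemma big_dual (T : Type) (idx : T) (op : Monoid.com_law idx)
    (F : label S -> T) a :
  \big[op/idx]_(c <- dual a) F c = \big[op/idx]_(c | letter c == a) F c.
Proof.
have [us ms] := dual_order a.
have Pd : perm_eq (dual a) (enum (labels_over S a)).
  by apply: uniq_perm; rewrite ?enum_uniq // => b; rewrite ms mem_enum.
by rewrite (perm_big _ Pd) big_enum; apply: eq_bigl => b; rewrite inE.
Qed.

(** One step of refinement: the chosen order of the labels over a lays out their
    intervals end to end, and by [m_split] they fill the interval of a. *)
Lemma sum_child_itv a k p x :
  (\sum_(b : label S | letter b == a)
      itv_at (p + phi b / lambda ^+ k) (width k.+1 (tag b)) x
   = itv_at p (width k a) x)%N.
Proof.
rewrite -big_dual m_split -big_dual mulr_suml.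
have [us ms] := dual_order a.
pose w (c : label S) := m (tag c) / lambda / lambda ^+ k.
rewrite -(itv_at_layout (w := w)) //; last first.
  by move=> c; rewrite !divr_ge0 ?exprn_ge0 // ltW.
rewrite [LHS]big_seq [RHS]big_seq; apply: eq_bigr => b bs.
have ba : letter b = a by move: bs; rewrite ms inE => /eqP.
rewrite /Defs.phi ba mulr_suml exprS invfM [_^-1 * _^-1]mulrC.
by rewrite mulrA mulrAC.
Qed.

(** A selection d of one label with each tag; it is applied to the first labels
    and to the last ones.  A length and a letter determine the address
    of that length that consists of selected labels and whose last label has that
    letter as its tag. *)
Section Selection.
Variable d : A -> label S.
Hypothesis tag_d : forall a, tag (d a) = a.

(** The left endpoint of the interval of the address [chain k a] below; unlike
    [Phi], it is also meaningful for the empty address. *)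
Fixpoint corner k a : R :=
  if k is k'.+1 then corner k' (letter (d a)) + phi (d a) / lambda ^+ k'
  else Phi0 a.

Definition cell_corner k (b : label S) : R :=
  corner k (letter b) + phi b / lambda ^+ k.

(** Splitting every interval of level k creates one interval for each label b,
    since the letter of b tells which interval it comes from; the selected labels
    correspond to letters through their tags and form level k + 1. *)
Lemma sum_level k x :
  (\sum_a itv_at (corner k a) (width k a) x =
   \sum_(b | b != d (tag b)) itv_at (cell_corner k b) (width k.+1 (tag b)) x
   + \sum_a itv_at (corner k.+1 a) (width k.+1 a) x)%N.
Proof.
under eq_bigr => a _ do rewrite -sum_child_itv.
have -> : (\sum_a \sum_(b | letter b == a)
    itv_at (corner k a + phi b / lambda ^+ k) (width k.+1 (tag b)) x =
    \sum_b itv_at (cell_corner k b) (width k.+1 (tag b)) x)%N.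
  rewrite [RHS](partition_big (@letter A S) predT) //=.
  by apply: eq_bigr => a _; apply: eq_bigr => b /eqP <-.
rewrite (bigID (fun b => b != d (tag b))) /=; congr addn.
rewrite (reindex_onto d (@tag _ _)) /=; last by move=> b; rewrite negbK => /eqP.
by apply: eq_big => a; rewrite ?tag_d ?eqxx //= => _.
Qed.

(** Stopping at an unselected label, or at length n if there is none, tiles the
    interval. *)
Lemma sum_levels n x :
  (\sum_(k < n) \sum_(b | b != d (tag b))
      itv_at (cell_corner k b) (width k.+1 (tag b)) x
   + \sum_a itv_at (corner n a) (width n a) x
   = \sum_a itv_at (Phi0 a) (m a) x)%N.
Proof.
elim: n => [|n IH].
  by rewrite big_ord0; apply: eq_bigr => a _; rewrite expr0 divr1.
by rewrite -IH big_ord_recr /= -addnA -sum_level.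
Qed.

Fixpoint chain k a : seq (label S) :=
  if k is k'.+1 then rcons (chain k' (letter (d a))) (d a) else [::].

Lemma size_chain k a : size (chain k a) = k.
Proof. by elim: k a => //= k IH a; rewrite size_rcons IH. Qed.

Lemma all_chain k a (P : pred (label S)) :
  (forall a, P (d a)) -> all P (chain k a).
Proof. by move=> Pd; elim: k a => //= k IH a; rewrite all_rcons Pd IH. Qed.

End Selection.

Lemma Phi_rcons (s : seq (label S)) c : (0 < size s)%N ->
  Phi (rcons s c) = Phi s + phi c / lambda ^+ size s.
Proof.
case: s => // b s _; rewrite rcons_cons.
have PhiE t : Phi (b :: t) = Phi0 (letter b)
    + \sum_(k < size (b :: t)) phi (nth b (b :: t) k) / lambda ^+ k by [].
rewrite !PhiE -rcons_cons size_rcons big_ord_recr /= -addrA.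
congr (_ + (_ + _)).
  apply: eq_bigr => k _; congr (phi _ / _).
  by rewrite -rcons_cons nth_rcons ltn_ord.
by rewrite nth_rcons ltnn eqxx.
Qed.

Lemma is_address_rcons (s : seq (label S)) b c :
  is_address (rcons (rcons s b) c) =
  is_address (rcons s b) && (letter c == tag b).
Proof.
case: s => [|e s]; first by rewrite /is_address /= finset.in_set andbT.
rewrite /is_address [rcons (rcons _ _) _]/= [sorted _ _]/= rcons_path.
by rewrite last_rcons finset.in_set.
Qed.

Lemma Phi1 c : Phi [:: c] = Phi0 (letter c) + phi c / lambda ^+ 0.
Proof. by rewrite /Defs.Phi /= big_ord_recl big_ord0 addr0. Qed.

Lemma address_itv_rcons (s : seq (label S)) c x :
  address_itv (rcons s c) x
  = itv_at (Phi (rcons s c)) (width (size s).+1 (tag c)) x.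
Proof.
case: s => [|b s]; first by rewrite /Defs.address_itv /= in_itv.
by rewrite rcons_cons /Defs.address_itv /= in_itv /= last_rcons size_rcons.
Qed.

Lemma chain_rcons_address d k b : (forall a, tag (d a) = a) ->
  is_address (rcons (chain d k (letter b)) b) /\
  Phi (rcons (chain d k (letter b)) b) = cell_corner d k b.
Proof.
move=> tag_d; elim: k b => [|k IH] b; first by split; [|exact: Phi1].
have [IHa IHP] := IH (d (letter b)); split.
  by rewrite [chain _ _ _]/= is_address_rcons IHa tag_d eqxx.
by rewrite [chain _ _ _]/= Phi_rcons ?size_rcons // IHP size_chain.
Qed.

Lemma address_itv_chain d k b x : (forall a, tag (d a) = a) ->
  address_itv (rcons (chain d k (letter b)) b) x =
  itv_at (cell_corner d k b) (width k.+1 (tag b)) x.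
Proof.
move=> tag_d; have [_ P] := chain_rcons_address k b tag_d.
by rewrite address_itv_rcons P size_chain.
Qed.

Hypothesis Phi0_tiling : forall x,
  (\sum_a itv_at (Phi0 a) (m a) x = itv_at 0 1 x)%N.

Lemma child_exists a k p x : itv_at p (width k a) x ->
  exists2 c, letter c = a &
    itv_at (p + phi c / lambda ^+ k) (width k.+1 (tag c)) x.
Proof.
move=> xp; have := sum_child_itv a k p x; rewrite xp => E.
have [|c /eqP ca cx] := @sum_bool_gt0 _ (fun c : label S => letter c == a)
    (fun c => itv_at (p + phi c / lambda ^+ k) (width k.+1 (tag c)) x).
  by rewrite E.
by exists c.
Qed.

Lemma child_uniq k p x b c : letter b = letter c ->
  itv_at (p + phi b / lambda ^+ k) (width k.+1 (tag b)) x ->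
  itv_at (p + phi c / lambda ^+ k) (width k.+1 (tag c)) x -> b = c.
Proof.
move=> bc bx cx.
apply: (@sum_bool_le1 _ (fun b : label S => letter b == letter c)
  (fun c => itv_at (p + phi c / lambda ^+ k) (width k.+1 (tag c)) x)) => //.
- by rewrite sum_child_itv; case: itv_at.
- exact/eqP.
Qed.

Lemma child_sub k p x b :
  itv_at (p + phi b / lambda ^+ k) (width k.+1 (tag b)) x ->
  itv_at p (width k (letter b)) x.
Proof.
move=> bx; have := sum_child_itv (letter b) k p x.
by rewrite (bigD1 b) //= bx; case: itv_at.
Qed.

Lemma address_itv_child (s : seq (label S)) b c x :
  address_itv (rcons (rcons s b) c) x =
  itv_at (Phi (rcons s b) + phi c / lambda ^+ (size s).+1)
         (width (size s).+2 (tag c)) x.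
Proof. by rewrite address_itv_rcons Phi_rcons ?size_rcons. Qed.

(** At the root the first letter is found from the tiling by [Phi0]; each later
    label is then found among the children of the previous interval. *)
Lemma address_uniq x (s t : seq (label S)) : size s = size t ->
  is_address s -> address_itv s x -> is_address t -> address_itv t x -> s = t.
Proof.
elim/last_ind: s t => [|s b IH] t //.
case/lastP: t => [|t c]; rewrite ?size_rcons //.
move=> [szst]; move: IH.
case/lastP: s szst => [|s b'] szst IH; case/lastP: t szst => [|t c'] szst;
  rewrite ?size_rcons // in szst *.
  rewrite !address_itv_rcons (Phi1 b) (Phi1 c) => _ bx _ cx; congr [:: _].
  have root_itv (e : label S) := @child_sub 0 (Phi0 (letter e)) x e.
  have bc : letter b = letter c.
    apply: (@sum_bool_le1 _ predT (fun a => itv_at (Phi0 a) (m a) x)) => //.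
    - by rewrite Phi0_tiling; case: itv_at.
    - by have := root_itv _ bx; rewrite expr0 divr1.
    - by have := root_itv _ cx; rewrite expr0 divr1.
  by rewrite bc in bx; exact: child_uniq bc bx cx.
rewrite !is_address_rcons !address_itv_child.
move=> /andP[sa /eqP bb'] bx /andP[ta /eqP cc'] cx.
have parent_itv u (e e' : label S) : letter e = tag e' ->
    itv_at (Phi (rcons u e') + phi e / lambda ^+ (size u).+1)
           (width (size u).+2 (tag e)) x -> address_itv (rcons u e') x.
  by move=> ee' /child_sub; rewrite ee' address_itv_rcons.
have E : rcons s b' = rcons t c'.
  apply: IH => //; rewrite ?size_rcons //.
  - exact: parent_itv bb' bx.
  - exact: parent_itv cc' cx.
have [_ Ebc] := rcons_inj E; case: szst => szst.
rewrite E; congr rcons; rewrite E szst in bx.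
by apply: child_uniq bx cx; rewrite bb' cc' Ebc.
Qed.

(** Descend from child to child, starting from the root interval of x; that no
    other address works is [address_uniq]. *)
Lemma coding_exists x : itv_at 0 1 x ->
  exists a, coding m lambda Phi0 dual x a.
Proof.
move=> x01; pose ok s := is_address s /\ address_itv s x.
have /choice[nx nxP] (s : seq (label S)) :
    exists c, s = [::] \/ ok s -> ok (rcons s c).
  case/lastP: s => [|s b].
    have [|a _ ax] := @sum_bool_gt0 _ predT (fun a => itv_at (Phi0 a) (m a) x).
      by rewrite Phi0_tiling x01.
    have [|c ca cx] := @child_exists a 0 (Phi0 a) x; first by rewrite expr0 divr1.
    by exists c => _; split=> //; rewrite address_itv_rcons Phi1 ca.
  case: (pselect (ok (rcons s b))) => [[sa sx]|nok]; last first.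
    by exists b => -[/(congr1 size)|//]; rewrite size_rcons.
  move: (sx); rewrite address_itv_rcons => /child_exists[c cb cx].
  exists c => _; split; first by rewrite is_address_rcons sa cb eqxx.
  by rewrite address_itv_child.
pose U n := iter n (fun s => rcons s (nx s)) [::].
have aU n : mkseq (nx \o U) n = U n.
  by elim: n => // n IH; rewrite mkseqS IH.
have okU n : ok (U n.+1).
  by elim: n => [|n IH]; apply: nxP; [left|right].
exists (nx \o U) => s s0; rewrite aU.
have [okA okI] := okU (size s).-1; rewrite prednK // in okA okI.
split=> [[sa sx]|->//]; apply: address_uniq sx okA okI => //.
by rewrite -aU size_mkseq.
Qed.

End Levels.

(** * First and last labels *)

Section Successor.
Variables (A : finType) (S : substitution A).

Lemma ltn_predn_letter (a : A) : ((size (S a)).-1 < size (S a))%N.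
Proof. by rewrite prednK // subst_letter_gt0. Qed.

Definition label_last (a : A) : label S :=
  Tagged (fun a => 'I_(size (S a))) (Ordinal (ltn_predn_letter a)).

Lemma label_eqP (b c : label S) :
  tag b = tag c -> tagged b = tagged c :> nat -> b = c.
Proof.
case: b c => a i [a' j] /= E; case: a' / E j => j E.
by have -> : i = j by apply: val_inj.
Qed.

Lemma is_lastE (b : label S) : is_last b = (b == label_last (tag b)).
Proof.
have b0 := subst_letter_gt0 S (tag b).
apply/eqP/eqP => [E|->] /=; last by rewrite prednK.
by apply: label_eqP => //; apply: succn_inj; rewrite E /= prednK.
Qed.

Lemma tagged_succ (b : label S) : ~~ is_last b ->
  tagged (label_succ b) = (tagged b).+1 :> nat.
Proof.
move=> bl; rewrite /label_succ /= val_insubd ifT //.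
by rewrite ltn_neqAle bl ltn_ord.
Qed.

Definition label_pred (b : label S) : label S :=
  Tagged (fun a => 'I_(size (S a))) (insubd (tagged b) (tagged b).-1).

Lemma tagged_pred (b : label S) : tagged (label_pred b) = (tagged b).-1 :> nat.
Proof.
by rewrite /label_pred /= val_insubd ifT // (leq_ltn_trans (leq_pred _)).
Qed.

Lemma label0P (b : label S) : (b == label0 S (tag b)) = (tagged b == 0 :> nat).
Proof.
apply/eqP/eqP => [->//|E]; exact: label_eqP.
Qed.

(** Incrementing is a bijection from the labels that are not last to those that
    are not first; it preserves tags, hence widths of intervals. *)
Lemma reindex_label_succ (T : Type) (idx : T) (op : Monoid.com_law idx)
    (F : label S -> T) :
  \big[op/idx]_(b | b != label0 S (tag b)) F b =
  \big[op/idx]_(b | ~~ is_last b) F (label_succ b).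
Proof.
have predK (b : label S) : b != label0 S (tag b) ->
    ~~ is_last (label_pred b) /\ label_succ (label_pred b) = b.
  rewrite label0P => b0.
  have nl : ~~ is_last (label_pred b).
    by rewrite /is_last tagged_pred; have := ltn_ord (tagged b); rewrite /=; lia.
  split=> //; apply: label_eqP => //.
  by rewrite tagged_succ // tagged_pred prednK // lt0n.
rewrite (reindex_onto (@label_succ A S) label_pred); last by move=> b /predK[].
apply: eq_bigl => b; apply/andP/idP => [[h /eqP <-]|nl].
  by case/predK: h.
split; first by rewrite label0P tagged_succ.
by apply/eqP/label_eqP => //; rewrite tagged_pred tagged_succ.
Qed.

Lemma card_is_last : #|[pred b : label S | is_last b]| = #|A|.
Proof.
have inj : injective label_last by move=> a a' /(congr1 (@tag _ _)).
rewrite -(card_codom inj); apply: eq_card => b; rewrite inE.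
apply/idP/codomP => [|[a ->]]; last by rewrite is_lastE.
by rewrite is_lastE => /eqP ->; exists (tag b).
Qed.

Lemma zero_addressE k (a : A) : zero_address S k a = chain (label0 S) k a.
Proof. by elim: k a => //= k IH a; rewrite IH. Qed.

Lemma vershik_chain k (b : label S) : ~~ is_last b ->
  vershik (rcons (chain label_last k (letter b)) b) =
  rcons (chain (label0 S) k (letter (label_succ b))) (label_succ b).
Proof.
move=> nl; rewrite /vershik.
have -> : find (predC (@is_last A S))
    (rcons (chain label_last k (letter b)) b) = k.
  rewrite -cats1 find_cat ifF /= ?nl ?addn0 ?size_chain //.
  apply/negbTE; rewrite -all_predC; apply: all_chain => a /=.
  by rewrite negbK is_lastE.
by rewrite -cats1 drop_size_cat ?size_chain // zero_addressE cats1.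
Qed.

Lemma carry_time_chain k (b : label S) (a : nat -> label S) :
  ~~ is_last b -> mkseq a k.+1 = rcons (chain label_last k (letter b)) b ->
  carry_time a k.+1.
Proof.
move=> nl; rewrite mkseqS => /rcons_inj[Ea Eb].
split=> //=; first by rewrite Eb.
move=> i ik; have := @all_chain A S label_last k (letter b) (@is_last A S).
rewrite -Ea => /(_ _)/allP; apply; first by move=> a'; rewrite is_lastE.
by apply: map_f; rewrite mem_iota.
Qed.

End Successor.

(** * The pieces of the exchange *)

Section Pieces.
Variables (R : realType) (A : finType) (S : substitution A).
Variables (m : A -> R) (lambda : R) (Phi0 : A -> R) (dual : A -> seq (label S)).
Hypothesis m_gt0 : forall a, 0 < m a.
Hypothesis lambda_gt0 : 0 < lambda.
Hypothesis m_split : forall a,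
  m a = \sum_(b : label S | letter b == a) m (tag b) / lambda.
Hypothesis dual_order : is_dual_order dual.
Hypothesis Phi0_tiling : forall x,
  (\sum_a itv_at (Phi0 a) (m a) x = itv_at 0 1 x)%N.
Variable n : nat.

Local Notation width k a := (m a / lambda ^+ k).
Definition nonlast : {pred label S} := [pred b | ~~ is_last b].

(** A piece is either a position k < n with a label that is not last, which is the
    label of index k of an address with last labels before it, or a letter for
    what remains at length n. *)
Definition piece : finType := ('I_n * {b in nonlast} + A)%type.

Definition piece_width (j : piece) : R :=
  match j with inl (k, b) => width k.+1 (tag (val b)) | inr a => width n a end.
Definition piece_source (j : piece) : R :=
  match j with
  | inl (k, b) => cell_corner m lambda Phi0 dual (@label_last A S) k (val b)
  | inr a => corner m lambda Phi0 dual (@label_last A S) n a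
  end.
Definition piece_target (j : piece) : R :=
  match j with
  | inl (k, b) =>
      cell_corner m lambda Phi0 dual (label0 S) k (label_succ (val b))
  | inr a => corner m lambda Phi0 dual (label0 S) n a
  end.

Lemma card_piece : #|piece| = (n * (#|{: label S}| - #|A|) + #|A|)%N.
Proof.
rewrite card_sum card_prod card_ord card_sig; congr (_ * _ + _)%N.
rewrite -(card_is_last S) -[#|{: label S}|](cardC [pred b | is_last b]) addKn.
by apply: eq_card => b; rewrite !inE.
Qed.

Lemma sum_piece (F : piece -> nat) :
  (\sum_j F j = \sum_(k < n) \sum_(b : {b in nonlast}) F (inl (k, b))
               + \sum_a F (inr a))%N.
Proof.
rewrite big_sumType /= pair_bigA; congr addn.
by apply: eq_bigr => -[].
Qed.

Lemma source_tiling x :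
  (\sum_j itv_at (piece_source j) (piece_width j) x = itv_at 0 1 x)%N.
Proof.
rewrite sum_piece -Phi0_tiling.
rewrite -(@sum_levels R A S m lambda Phi0 dual m_gt0 lambda_gt0 m_split
  dual_order (@label_last A S) (fun=> erefl) n).
congr addn; apply: eq_bigr => k _.
rewrite -(big_sub nonlast (fun b => nat_of_bool (itv_at
  (cell_corner m lambda Phi0 dual (@label_last A S) k b)
  (width k.+1 (tag b)) x))).
by apply: eq_bigl => b; rewrite inE is_lastE.
Qed.

Lemma target_tiling x :
  (\sum_j itv_at (piece_target j) (piece_width j) x = itv_at 0 1 x)%N.
Proof.
rewrite sum_piece -Phi0_tiling.
rewrite -(@sum_levels R A S m lambda Phi0 dual m_gt0 lambda_gt0 m_split
  dual_order (label0 S) (fun=> erefl) n).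
congr addn; apply: eq_bigr => k _.
rewrite reindex_label_succ -(big_sub nonlast (fun b => nat_of_bool (itv_at
  (cell_corner m lambda Phi0 dual (label0 S) k (label_succ b))
  (width k.+1 (tag b)) x))).
by apply: eq_bigl => b; rewrite inE.
Qed.

Lemma piece_width_gt0 j : 0 < piece_width j.
Proof. by case: j => [[k b]|a] /=; rewrite divr_gt0 ?exprn_gt0. Qed.

(** Each x in the piece has an address starting with k last labels and b, so that
    F increments b and resets the labels before it: it translates the source of
    the piece to its target. *)
Lemma frakF_on_piece (k : 'I_n) (b : {b in nonlast}) x :
  itv_at (piece_source (inl (k, b))) (piece_width (inl (k, b))) x ->
  frakF_graph m lambda Phi0 dual x
    (x + (piece_target (inl (k, b)) - piece_source (inl (k, b)))).
Proof.
move=> xb; have nl : ~~ is_last (val b) := valP b.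
have x01 : itv_at 0 1 x.
  by have := source_tiling x; rewrite (bigD1 (inl (k, b))) //= xb; case: itv_at.
have [a xa] := @coding_exists R A S m lambda Phi0 dual m_gt0 lambda_gt0
  m_split dual_order Phi0_tiling x x01.
have tl (e : A) : tag (label_last S e) = e by [].
have [addr PhiE] :=
  @chain_rcons_address R A S m lambda Phi0 dual (@label_last A S) k (val b) tl.
have [_ PhiE'] :=
  @chain_rcons_address R A S m lambda Phi0 dual (label0 S) k
    (label_succ (val b)) (fun=> erefl).
pose s := rcons (chain (@label_last A S) k (letter (val b))) (val b).
have aE : mkseq a k.+1 = s.
  have sk : size s = k.+1 by rewrite size_rcons size_chain.
  rewrite -sk; apply/esym/xa; first by rewrite sk.
  by split=> //; rewrite address_itv_chain.
exists a, k.+1; split=> //; first exact: carry_time_chain aE.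
by rewrite aE /s vershik_chain // PhiE PhiE' /=; ring.
Qed.

End Pieces.

(** * The exchange *)

Lemma tiling_of_partition (R : realType) (A : finType) (l w : A -> R) x :
  partition [set: A] (fun a => `[l a, l a + w a[%classic) `[0, 1[%classic ->
  (\sum_a itv_at (l a) (w a) x = itv_at 0 1 x)%N.
Proof.
move=> [cov triv _].
have itvE p v : (`[p, p + v[%classic : set R) x = itv_at p v x.
  by rewrite /= in_itv.
have [[a ax] | nx] := pselect (exists a, itv_at (l a) (w a) x).
  have -> : itv_at 0 1 x.
    by rewrite -itvE add0r -cov; exists a; rewrite ?itvE.
  rewrite (bigD1 a) //= ax big1 // => b ba; apply/eqP; rewrite eqb0.
  apply: contra_neqN ba => bx; apply: triv => //.
  by exists x; split; rewrite itvE.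
rewrite big1 => [|a _]; last first.
  by apply/eqP; rewrite eqb0; apply/negP => ax; apply: nx; exists a.
apply/esym/eqP; rewrite eqb0; apply/negP; rewrite -itvE add0r -cov => -[a _].
by rewrite itvE => ax; apply: nx; exists a.
Qed.

Theorem corollary4p6 (R : realType) (A : alphabetType) (S : substitution A)
  (lambda : R) (mu : probability (borel_full_shift A) R)
  (Phi0 : A -> R) (dual : A -> seq (label S))
  (S_recognizable : recognizable S)
  (S_minimal : minimal_subshift S)
  (lambda_PF : perron_frobenius (subst_mx R S) lambda)
  (lambda_gt1 : 1 < lambda)
  (mu_invariant : invariant_on_subshift S mu)
  (mu_gt0 : forall a : A, 0 < letter_mass S mu a)
  (mu_scaling : forall (a : A) (n : nat),
     mu (iter n (subst_bi S) @` cylinder S a)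
     = (letter_mass S mu a / lambda ^+ n)%:E)
  (Phi0_partition :
     partition [set: A]
       (fun a => `[Phi0 a, Phi0 a + letter_mass S mu a[%classic)
       `[0, 1[%classic)
  (dual_order : is_dual_order dual)
  (n : nat) :
  let r := (n * (#|{: label S}| - #|A|) + #|A|)%N in
  exists (f : R -> R) (l u : 'I_r -> R) (B : {set 'I_r}),
    [/\ interval_exchange l u f,
        #|B| = #|A|,
        (\sum_(i in B) lebesgue_measure `[l i, u i[%classic
           <= (lambda ^- n)%:E)%E
      & forall i x, i \notin B -> x \in `[l i, u i[ ->
          frakF_graph (letter_mass S mu) lambda Phi0 dual x (f x)].
Proof.
move=> r; set m := letter_mass S mu.
have lambda_gt0 : 0 < lambda by apply: lt_trans lambda_gt1.
have m_sum : \sum_a m a = 1 by exact: sum_letter_mass mu_invariant mu_scaling.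
have m_split : forall a,
    m a = \sum_(b : label S | letter b == a) m (tag b) / lambda.
  exact: letter_mass_split S_recognizable mu_invariant mu_scaling.
have Phi0_tiling x : (\sum_a itv_at (Phi0 a) (m a) x = itv_at 0 1 x)%N.
  exact: tiling_of_partition.
pose l := piece_source m lambda Phi0 dual (n := n).
pose l' := piece_target m lambda Phi0 dual (n := n).
pose w := piece_width m lambda (S := S) (n := n).
(* A numbering of the pieces by 'I_r. *)
pose g (i : 'I_r) : piece S n := enum_val (cast_ord (esym (card_piece S n)) i).
have g_bij : bijective g.
  apply: bij_comp; first exact: enum_val_bij.
  exact: (Bijective (cast_ordK _) (cast_ordKV _)).
have tiling_g (k : piece S n -> R) x :
    (\sum_j itv_at (k j) (w j) x = itv_at 0 1 x)%N ->
    (\sum_i itv_at (k (g i)) (w (g i)) x = itv_at 0 1 x)%N.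
  by move=> <-; rewrite [RHS](reindex g) //; exact: onW_bij.
have l_tiling x := tiling_g l x
  (source_tiling mu_gt0 lambda_gt0 m_split dual_order Phi0_tiling n x).
have l'_tiling x := tiling_g l' x
  (target_tiling mu_gt0 lambda_gt0 m_split dual_order Phi0_tiling n x).
have w_gt0 i : 0 < w (g i) by exact: piece_width_gt0.
(* The pieces left over at length n, on which the exchange need not follow F. *)
pose residual (j : piece S n) := if j is inr _ then true else false.
pose B : {set 'I_r} := finset (fun i => residual (g i)).
have sumB (T : Type) (idx : T) (op : Monoid.com_law idx) (F : piece S n -> T) :
    \big[op/idx]_(i in B) F (g i) = \big[op/idx]_(a : A) F (inr a).
  transitivity (\big[op/idx]_(j | residual j) F j).
    rewrite [RHS](reindex g); last exact: onW_bij.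
    by apply: eq_bigl => i; rewrite inE.
  by rewrite big_sumType /= big_pred0_eq Monoid.mul1m.
exists (translate_pieces (l \o g) (l' \o g) (w \o g)), (l \o g),
  (fun i => l (g i) + w (g i)), B.
split.
- exact: translate_exchange.
- by rewrite -sum1_card (sumB _ _ _ (fun=> 1%N)) sum1_card.
- rewrite (eq_bigr (fun i => (w (g i))%:E)); last first.
    move=> i _; rewrite lebesgue_measure_itv /= lte_fin ltrDl w_gt0.
    by rewrite -EFinD addrAC subrr add0r.
  rewrite (sumB _ _ _ (fun j => (w j)%:E)) sumEFin lee_fin /w /=.
  by rewrite -mulr_suml m_sum mul1r.
- move=> i x iB; rewrite in_itv => xi.
  rewrite (@translateE R r (l \o g) (l' \o g) (w \o g) l_tiling i x xi).
  move: iB xi; rewrite inE /=; case: (g i) => [[k b]|a] // _ xi.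
  exact: (frakF_on_piece mu_gt0).
Qed.
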